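(* Let $\{(\mathbf{x}_1^k,\mathbf{x}_2^k,\lambda^k)\}$ be generated by the standard two-block ADMM with parameter $\rho>0$ applied to $$\min_{\mathbf{x}_1,\mathbf{x}_2}\ f_1(\mathbf{x}_1)+f_2(\mathbf{x}_2)\quad\text{s.t.}\quad A_1\mathbf{x}_1+A_2\mathbf{x}_2=c,$$ and let $\mathbf{w}^k=(\mathbf{x}_2^k,\lambda^k)$. Then $\{\mathbf{w}^k\}$ converges to a solution $\mathbf{w}^*$ of the problem in the $H$-norm, i.e. $\|\mathbf{w}^k-\mathbf{w}^*\|_H^2\to 0$, and $\|\mathbf{w}^k-\mathbf{w}^{k+1}\|_H^2=o(1/k)$. Therefore, $$\|A_1\mathbf{x}_1^k-A_1\mathbf{x}_1^{k+1}\|^2+\|A_2\mathbf{x}_2^k-A_2\mathbf{x}_2^{k+1}\|^2+\|\lambda^k-\lambda^{k+1}\|^2=o(1/k)$$ as $k\to\infty$.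
   Context: Setting: $\mathbf{x}_i\in\mathbb{R}^{n_i}$, $A_i\in\mathbb{R}^{m\times n_i}$ ($i=1,2$), $c\in\mathbb{R}^m$, and $f_i:\mathbb{R}^{n_i}\to(-\infty,+\infty]$ are closed proper convex functions. It is assumed that a saddle point (KKT point) exists, i.e. some $(\mathbf{x}_1^*,\mathbf{x}_2^*,\lambda^* )$ with $\lambda^*\in\mathbb{R}^m$, $A_i^\top\lambda^*\in\partial f_i(\mathbf{x}_i^* )$ for $i=1,2$, and $A_1\mathbf{x}_1^*+A_2\mathbf{x}_2^*=c$. A ''solution $\mathbf{w}^*$'' is the part $\mathbf{w}^*=(\mathbf{x}_2^*,\lambda^* )$ of such a point. Two-block ADMM: from arbitrary $\mathbf{x}^0,\lambda^0$, for $k=0,1,\dots$, $$\mathbf{x}_1^{k+1}\in\operatorname*{arg\,min}_{\mathbf{x}_1} f_1(\mathbf{x}_1)+\frac{\rho}{2}\Big\|A_1\mathbf{x}_1+A_2\mathbf{x}_2^k-c-\frac{\lambda^k}{\rho}\Big\|^2,$$ $$\mathbf{x}_2^{k+1}\in\operatorname*{arg\,min}_{\mathbf{x}_2} f_2(\mathbf{x}_2)+\frac{\rho}{2}\Big\|A_1\mathbf{x}_1^{k+1}+A_2\mathbf{x}_2-c-\frac{\lambda^k}{\rho}\Big\|^2,$$ $$\lambda^{k+1}=\lambda^k-\rho(A_1\mathbf{x}_1^{k+1}+A_2\mathbf{x}_2^{k+1}-c).$$ The minimizers defining the iterates are taken to exist (the sequence is generated by the algorithm). $H:=\operatorname{blockdiag}\big(\rho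 A_2^\top A_2,\frac1\rho\mathbf{I}\big)$ with $\mathbf{I}$ the $m\times m$ identity, and $\|\mathbf{w}\|_H^2:=\mathbf{w}^\top H\mathbf{w}$ (a semi-norm in general). $\|\cdot\|$ is the Euclidean norm.
   Formalization: That the limit w* is a solution is claimed only when the ADMM minimizers exist from every starting pair (x_2, λ), not merely along the given sequence; otherwise it can fail. Convergence to some w* and both o(1/k) rates hold without this. *)

(* Defs.v *)
From HB Require Import structures.
From mathcomp Require Import all_boot all_order all_algebra.
From mathcomp Require Import all_classical all_reals all_analysis.

Set Implicit Arguments.
Unset Strict Implicit.
Unset Printing Implicit Defensive.

Import Order.TTheory GRing.Theory Num.Theory.
Import numFieldNormedType.Exports.

Local Open Scope classical_set_scope.
Local Open Scope ring_scope.

Section EuclideanSpace.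
Context {R : realType}.

(* The library norm on matrices is the sup norm, so the Euclidean structure is
   written out. *)
Definition dot n (u v : 'cV[R]_n) : R := (u^T *m v) 0 0.

Definition sqnorm n (u : 'cV[R]_n) : R := dot u u.

Definition sqnorm_mx n (H : 'M[R]_n) (w : 'cV[R]_n) : R :=
  (w^T *m H *m w) 0 0.

End EuclideanSpace.

Section ConvexAnalysis.
Context {R : realType} {n : nat}.
Implicit Types (f : 'cV[R]_n -> \bar R) (x g : 'cV[R]_n).

Definition proper f := (forall x, f x != -oo%E) /\ (exists x, f x != +oo%E).

(* For functions that never take the value -oo; the library convention
   0 * +oo = 0 makes the cases t = 0 and t = 1 trivial. *)
Definition convex_efun f := forall (x y : 'cV[R]_n) (t : R), 0 <= t <= 1 ->
  (f (t *: x + (1 - t) *: y)%R <= t%:E * f x + (1 - t)%R%:E * f y)%E.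

(* For a proper convex function, closed means lower semicontinuous. *)
Definition closed_proper_convex f :=
  [/\ lower_semicontinuous f, proper f & convex_efun f].

Definition subdifferential f x : set 'cV[R]_n :=
  [set g | forall y : 'cV[R]_n, (f x + (dot g (y - x)%R)%:E <= f y)%E].

Definition argmin f : set 'cV[R]_n := [set x | forall y : 'cV[R]_n, (f x <= f y)%E].

End ConvexAnalysis.

Section ADMM.
Context {R : realType} {n1 n2 m : nat}.
Variables (f1 : 'cV[R]_n1 -> \bar R) (f2 : 'cV[R]_n2 -> \bar R).
Variables (A1 : 'M[R]_(m, n1)) (A2 : 'M[R]_(m, n2)) (c : 'cV[R]_m) (rho : R).

Definition KKT_point (x1 : 'cV[R]_n1) (x2 : 'cV[R]_n2) (lam : 'cV[R]_m) :=
  [/\ subdifferential f1 x1 (A1^T *m lam),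
      subdifferential f2 x2 (A2^T *m lam)
    & A1 *m x1 + A2 *m x2 = c].

Definition penalty (x1 : 'cV[R]_n1) (x2 : 'cV[R]_n2) (lam : 'cV[R]_m) : R :=
  rho / 2 * sqnorm (A1 *m x1 + A2 *m x2 - c - rho^-1 *: lam).

Definition ADMM_step (x2 : 'cV[R]_n2) (lam : 'cV[R]_m)
    (x1' : 'cV[R]_n1) (x2' : 'cV[R]_n2) (lam' : 'cV[R]_m) :=
  [/\ argmin (fun x1 => f1 x1 + (penalty x1 x2 lam)%:E)%E x1',
      argmin (fun x2 => f2 x2 + (penalty x1' x2 lam)%:E)%E x2'
    & lam' = lam - rho *: (A1 *m x1' + A2 *m x2' - c)].

(* x1 0, x2 0 and lam 0 are arbitrary. *)
Definition ADMM_sequence (x1 : nat -> 'cV[R]_n1) (x2 : nat -> 'cV[R]_n2)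
    (lam : nat -> 'cV[R]_m) :=
  forall k, ADMM_step (x2 k) (lam k) (x1 k.+1) (x2 k.+1) (lam k.+1).

(* The minimizers defining the iterates exist whatever the initial data.  If
   they are only known to exist along one sequence, A2 x2^k may tend to a
   boundary point of A2 (dom f2) that does not belong to it, as this set need
   not be closed; no solution then represents the limit. *)
Definition ADMM_well_defined :=
  forall x2 lam,
    exists x1' x2' lam', ADMM_step x2 lam x1' x2' lam'.

Definition wvec (x2 : 'cV[R]_n2) (lam : 'cV[R]_m) : 'cV[R]_(n2 + m) := col_mx x2 lam.

Definition is_solution (w : 'cV[R]_(n2 + m)) :=
  exists x1 x2 lam, KKT_point x1 x2 lam /\ w = wvec x2 lam.

Definition Hmx : 'M[R]_(n2 + m) :=
  block_mx (rho *: (A2^T *m A2)) 0 0 (rho^-1)%:M.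

End ADMM.

(* Main.v *)
Require Import Defs.
From HB Require Import structures.
From mathcomp Require Import all_boot all_order all_algebra.
From mathcomp Require Import all_classical all_reals all_analysis.
From mathcomp Require Import zify ring lra.

Set Implicit Arguments.
Unset Strict Implicit.
Unset Printing Implicit Defensive.

Import Order.TTheory GRing.Theory Num.Theory.
Import numFieldNormedType.Exports.

Local Open Scope classical_set_scope.
Local Open Scope ring_scope.

(* In terms of optimality conditions, the map (x2, lambda) -> (x2', lambda') of one ADMM
   step is nonexpansive for the H-semi-norm, by monotonicity of the two
   subdifferentials, and KKT points are fixed points of it.  Hence the residuals
   d_k = |w^k - w^{k+1}|_H^2 are nonincreasing; comparing with a KKT point w* gives
   |w^{k+1} - w*|_H^2 + d_k <= |w^k - w*|_H^2 for k >= 1, so they are summable, and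
   a nonincreasing summable sequence is o(1/k).  For the convergence, a bounded
   orbit of a nonexpansive map with vanishing residuals converges to each of its
   cluster points, whether or not the map is defined there.  If it is, one further
   step from the limit stays at the limit in the semi-norm, and a fixed point of
   a step is a KKT point. *)

(** * Euclidean inner product and norm on column vectors *)

Section Euclidean.
Context {R : realType}.

Lemma dotE n (u v : 'cV[R]_n) : dot u v = \sum_i u i 0 * v i 0.
Proof. by rewrite /dot mxE; apply: eq_bigr => i _; rewrite mxE. Qed.

Lemma dotC n (u v : 'cV[R]_n) : dot u v = dot v u.
Proof. by rewrite !dotE; apply: eq_bigr => i _; rewrite mulrC. Qed.

Lemma dotDl n (u v w : 'cV[R]_n) : dot (u + v) w = dot u w + dot v w.
Proof. by rewrite /dot linearD mulmxDl mxE. Qed.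

Lemma dotDr n (u v w : 'cV[R]_n) : dot w (u + v) = dot w u + dot w v.
Proof. by rewrite /dot mulmxDr mxE. Qed.

Lemma dotNl n (u v : 'cV[R]_n) : dot (- u) v = - dot u v.
Proof. by rewrite /dot linearN mulNmx mxE. Qed.

Lemma dotNr n (u v : 'cV[R]_n) : dot u (- v) = - dot u v.
Proof. by rewrite /dot mulmxN mxE. Qed.

Lemma dotZl n a (u v : 'cV[R]_n) : dot (a *: u) v = a * dot u v.
Proof. by rewrite /dot linearZ -scalemxAl mxE. Qed.

Lemma dotZr n a (u v : 'cV[R]_n) : dot u (a *: v) = a * dot u v.
Proof. by rewrite /dot -scalemxAr mxE. Qed.

Definition dot_expand := (@dotDl, @dotDr, @dotNl, @dotNr, @dotZl, @dotZr).

Lemma dot_trmx p n (A : 'M[R]_(p, n)) u v : dot (A^T *m u) v = dot u (A *m v).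
Proof. by rewrite /dot trmx_mul trmxK mulmxA. Qed.

Lemma sqnorm_ge0 n (u : 'cV[R]_n) : 0 <= sqnorm u.
Proof. by rewrite /sqnorm dotE sumr_ge0 // => i _; rewrite -expr2 sqr_ge0. Qed.

Lemma sqnorm0 n : sqnorm (0 : 'cV[R]_n) = 0.
Proof. by rewrite /sqnorm /dot mulmx0 mxE. Qed.

Lemma sqnormN n (u : 'cV[R]_n) : sqnorm (- u) = sqnorm u.
Proof. by rewrite /sqnorm dotNl dotNr opprK. Qed.

Lemma sqnormZ n a (u : 'cV[R]_n) : sqnorm (a *: u) = a ^+ 2 * sqnorm u.
Proof. by rewrite /sqnorm dotZl dotZr; ring. Qed.

Lemma sqr_coord_le_sqnorm n (u : 'cV[R]_n) i : u i 0 ^+ 2 <= sqnorm u.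
Proof.
rewrite /sqnorm dotE (bigD1 i) //= -expr2 lerDl sumr_ge0 // => j _.
by rewrite -expr2 sqr_ge0.
Qed.

Lemma sqnorm_eq0 n (u : 'cV[R]_n) : sqnorm u = 0 -> u = 0.
Proof.
move=> u0; apply/matrixP => i j; rewrite ord1 mxE; apply/eqP.
by rewrite -sqrf_eq0 eq_le sqr_ge0 andbT -u0 sqr_coord_le_sqnorm.
Qed.

(** The squared norm of |v|^2 u - <u,v> v is nonnegative and factors as |v|^2 times the gap in the
    inequality. *)
Lemma cauchy_schwarz n (u v : 'cV[R]_n) :
  dot u v ^+ 2 <= sqnorm u * sqnorm v.
Proof.
have [v0|v0] := eqVneq (sqnorm v) 0.
  by rewrite v0 mulr0 (sqnorm_eq0 v0) /dot mulmx0 mxE expr0n.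
have v_gt0 : 0 < sqnorm v by rewrite lt_def v0 sqnorm_ge0.
have := sqnorm_ge0 (sqnorm v *: u - dot u v *: v).
have -> : sqnorm (sqnorm v *: u - dot u v *: v) =
    sqnorm v * (sqnorm u * sqnorm v - dot u v ^+ 2).
  by rewrite {1}/sqnorm !dot_expand (dotC v u) -/(sqnorm u) -/(sqnorm v); ring.
by rewrite pmulr_rge0 // subr_ge0.
Qed.

Lemma sqnormD_le n (u v : 'cV[R]_n) : sqnorm (u + v) <= 2 * sqnorm u + 2 * sqnorm v.
Proof.
have := sqnorm_ge0 (u - v); rewrite /sqnorm !dot_expand (dotC v u).
by lra.
Qed.

Lemma sqnorm_col_mx p q (u : 'cV[R]_p) (v : 'cV[R]_q) :
  sqnorm (col_mx u v) = sqnorm u + sqnorm v.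
Proof. by rewrite /sqnorm /dot tr_col_mx mul_row_col mxE. Qed.

(** The norm itself serves where the factor 2 of [sqnormD_le] would be too costly, namely for the
    monotonicity of distances to a cluster point. *)
Definition enorm n (u : 'cV[R]_n) : R := Num.sqrt (sqnorm u).

Lemma enorm_ge0 n (u : 'cV[R]_n) : 0 <= enorm u.
Proof. exact: sqrtr_ge0. Qed.

Lemma sqr_enorm n (u : 'cV[R]_n) : enorm u ^+ 2 = sqnorm u.
Proof. by rewrite sqr_sqrtr // sqnorm_ge0. Qed.

Lemma enorm_triangle n (u v : 'cV[R]_n) : enorm (u + v) <= enorm u + enorm v.
Proof.
rewrite -(@ler_pXn2r _ 2) ?nnegrE ?addr_ge0 ?enorm_ge0 //.
rewrite sqrrD !sqr_enorm {1}/sqnorm !dot_expand (dotC v u).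
rewrite -/(sqnorm u) -/(sqnorm v).
have dle : dot u v <= enorm u * enorm v.
  rewrite (le_trans (ler_norm _)) // -(@ler_pXn2r _ 2) ?nnegrE ?mulr_ge0 ?enorm_ge0 //.
  by rewrite exprMn !sqr_enorm -normrX ger0_norm ?sqr_ge0 // cauchy_schwarz.
by lra.
Qed.

End Euclidean.

(** * Orbits of nonexpansive maps in a semi-norm, and o(1/k) rates *)

Section Fejer.
Context {R : realType}.

Lemma sqnorm_mulmx_continuous q n (B : 'M[R]_(q, n)) (p : 'rV[R]_n) :
  continuous (fun x : 'rV[R]_n => sqnorm (B *m (x - p)^T) : R).
Proof.
have -> : (fun x : 'rV[R]_n => sqnorm (B *m (x - p)^T)) =
    (fun x => \sum_i (\sum_j B i j * (x 0 j - p 0 j)) * (\sum_j B i j * (x 0 j - p 0 j))).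
  apply/funext => x; rewrite /sqnorm dotE; apply: eq_bigr => i _.
  by rewrite !mxE; congr (_ * _); apply: eq_bigr => j _; rewrite !mxE.
apply: continuous_big; first exact: add_continuous.
move=> i _ x.
have cx : continuous (fun y : 'rV[R]_n => \sum_j B i j * (y 0 j - p 0 j)).
  apply: continuous_big; first exact: add_continuous.
  move=> j _ y.
  have cj : (fun z : 'rV[R]_n => z 0 j) @ y --> y 0 j by exact: coord_continuous.
  exact: (cvgMr (cvgB cj (cvg_cst (p 0 j)))).
exact: (cvgM (cx x) (cx x)).
Qed.

(* The points [w k] themselves need not be bounded; their images under [B] are,
   and the pseudo-inverse selects bounded preimages of these. *)
Lemma bounded_image_cluster q n (B : 'M[R]_(q, n)) (w : nat -> 'cV[R]_n) (M : R) :
  (forall k, sqnorm (B *m w k) <= M) ->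
  exists v : 'cV[R]_n, forall eps N, 0 < eps ->
    exists2 k, (N <= k)%N & sqnorm (B *m (w k - v)) < eps.
Proof.
move=> leM; pose r k : 'rV[R]_n := (B *m w k)^T *m pinvmx B^T.
have rE k : B *m (r k)^T = B *m w k.
  apply: trmx_inj; rewrite trmx_mul trmxK mulmxKpV //.
  by rewrite trmx_mul submxMl.
(* Each coordinate a of an image satisfies 2|a| <= 1 + a^2 <= 1 + M, which bounds it without a
   square root. *)
pose K j := \sum_i (1 + M) * `|pinvmx B^T i j|.
have rK k : forall j, `[- K j, K j]%classic (r k 0 j).
  move=> j; rewrite /= in_itv /= -ler_norml mxE.
  rewrite (le_trans (ler_norm_sum _ _ _)) // ler_sum // => i _.
  rewrite normrM ler_wpM2r // mxE.
  have := le_trans (sqr_coord_le_sqnorm (B *m w k) i) (leM k).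
  set a := (B *m w k) i 0; have := sqr_ge0 (`|a| - 1).
  rewrite sqrrB1 real_normK ?num_real // => h1 h2.
  by have := normr_ge0 a; have := sqr_ge0 a; lra.
have rcpt : (r @ \oo) [set x | forall j, `[- K j, K j]%classic (x ord0 j)].
  by exists 0%N => // k _ j; exact: rK.
have [p [_ clp]] := rV_compact (fun j => @segment_compact R (- K j) (K j)) _ rcpt.
exists p^T => eps N eps0.
have near_p : nbhs p [set x : 'rV[R]_n | sqnorm (B *m (x - p)^T) < eps].
  have : (fun x : 'rV[R]_n => sqnorm (B *m (x - p)^T)) @ p --> (0 : R).
    have := @sqnorm_mulmx_continuous q n B p p.
    by rewrite /continuous_at subrr trmx0 mulmx0 sqnorm0.
  by move/cvgr_lt; apply.
have tail : (r @ \oo) (r @` [set k | (N <= k)%N]).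
  by exists N => // k /= Nk; exists k.
have [_ [[k /= Nk <-]]] := clp _ _ tail near_p.
rewrite /= linearB /= mulmxBr rE -mulmxBr => lt_eps.
by exists k.
Qed.

(** Let v be a cluster point and w_j close to it with j large. Going from w_{k+1} to v through
    w_{j+1} and w_j shows that the distance to v does not increase with k, up to an arbitrarily
    small error. Being small infinitely often, it tends to 0. *)
Lemma nonexpansive_orbit_cvg q n (B : 'M[R]_(q, n)) (w : nat -> 'cV[R]_n) (M : R) :
  (forall k, sqnorm (B *m w k) <= M) ->
  (forall j k, sqnorm (B *m (w j.+1 - w k.+1)) <= sqnorm (B *m (w j - w k))) ->
  (fun k => sqnorm (B *m (w k - w k.+1))) @ \oo --> (0 : R) ->
  exists v : 'cV[R]_n, (fun k => sqnorm (B *m (w k - v))) @ \oo --> (0 : R).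
Proof.
move=> leM nonexp reg.
have [v clv] := bounded_image_cluster leM.
exists v.
have fejer k : sqnorm (B *m (w k.+1 - v)) <= sqnorm (B *m (w k - v)).
  rewrite -ler_sqrt ?sqnorm_ge0 // -![Num.sqrt _]/(enorm _).
  apply/ler_addgt0Pr => e e0.
  have e3 : 0 < (e / 3) ^+ 2 by rewrite exprn_gt0 // divr_gt0.
  have [N _ regN] : \forall j \near \oo, sqnorm (B *m (w j - w j.+1)) < (e / 3) ^+ 2.
    by move/cvgr_lt: reg; apply.
  have [j Nj clj] := clv _ N e3.
  have small x : sqnorm (B *m x) < (e / 3) ^+ 2 -> enorm (B *m x) <= e / 3.
    move=> xe; rewrite -(@ler_pXn2r _ 2) ?nnegrE ?enorm_ge0 ?divr_ge0 ?(ltW e0) //.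
    by rewrite sqr_enorm ltW.
  have h1 := small _ clj; have h2 := small _ (regN _ Nj).
  have h3 : enorm (B *m (w k.+1 - w j.+1)) <= enorm (B *m (w k - w j)).
    by rewrite ler_sqrt ?sqnorm_ge0.
  have h1' : enorm (B *m (v - w j)) <= e / 3.
    by rewrite /enorm -opprB mulmxN sqnormN.
  have h2' : enorm (B *m (w j.+1 - w j)) <= e / 3.
    by rewrite /enorm -opprB mulmxN sqnormN.
  have t1 := enorm_triangle (B *m (w k.+1 - w j.+1)) (B *m (w j.+1 - v)).
  have t2 := enorm_triangle (B *m (w j.+1 - w j)) (B *m (w j - v)).
  have t3 := enorm_triangle (B *m (w k - v)) (B *m (v - w j)).
  rewrite -!mulmxDr !addrA !subrK in t1 t2 t3.
  by lra.
have fejer_le : {homo (fun k => sqnorm (B *m (w k - v))) : i j / (i <= j)%N >-> j <= i}.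
  by apply: (homo_leq (r := fun x y => y <= x)) => // y x z xy yz; exact: le_trans yz xy.
apply/cvgrPdist_le => e e0.
have [N _ leN] := clv _ 0%N e0.
exists N => // k /= Nk.
rewrite sub0r normrN ger0_norm ?sqnorm_ge0 //.
exact: le_trans (fejer_le _ _ Nk) (ltW leN).
Qed.

Lemma nonincreasing_summable_littleo (d e : nat -> R) :
  (forall k, 0 <= e k) -> (forall k, 0 <= d k) ->
  (forall k, d k.+1 <= d k) -> (forall k, e k.+1 + d k <= e k) ->
  forall eps, 0 < eps -> \forall k \near \oo, k.+2%:R * d k <= eps.
Proof.
move=> e0 d0 dS ed eps eps0.
have eS : {homo e : i j / (i <= j)%N >-> j <= i}.
  apply: (homo_leq (r := fun x y => y <= x)) => // [y x z xy yz|k].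
    exact: le_trans yz xy.
  by have := ed k; have := d0 k; lra.
have elb : has_lbound (range e) by exists 0 => _ [k _ <-].
have ecvg := nonincreasing_is_cvgn eS elb.
have elim k : limn e <= e k by exact: nonincreasing_cvgn_ge.
have [N _ eN] : \forall k \near \oo, e k < limn e + eps / 2.
  by move/cvgr_lt: ecvg; apply; rewrite ltrDl divr_gt0.
(* The residuals of indices N to N + k telescope, and the last is the smallest. *)
have tail k : k.+1%:R * d (N + k)%N <= e N - e (N + k).+1.
  elim: k => [|k IH]; first by rewrite addn0 mul1r; have := ed N; lra.
  have := ed (N + k.+1)%N; have := dS (N + k)%N; rewrite !addnS => h1 h2.
  have : k.+1%:R * d (N + k).+1 <= k.+1%:R * d (N + k)%N by rewrite ler_wpM2l.
  by rewrite -(natr1 k.+1) mulrDl mul1r; lra.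
exists (2 * N)%N => // k /= Nk.
have NkE : (N + (k - N))%N = k by rewrite subnKC // (leq_trans _ Nk) // leq_pmull.
have := tail (k - N)%N; rewrite NkE => tk.
(* This is where k >= 2N enters: then k + 2 <= 2(k - N + 1). *)
have : k.+2%:R * d k <= 2 * ((k - N).+1%:R * d k).
  by rewrite mulrA -natrM ler_wpM2r // ler_nat; lia.
have := eN N (leqnn N); have := elim k.+1; lra.
Qed.

(** The shift by two leaves room for estimates that only hold after the first iterations; the weight
    k + 2 matches the index of g. *)
Lemma littleo_inv_nat (d g : nat -> R) (C : R) : 0 < C ->
  (forall eps, 0 < eps -> \forall k \near \oo, k.+2%:R * d k <= eps) ->
  (forall k, 0 <= g k) -> (forall k, g k.+2 <= C * d k) ->
  (g : nat -> R^o) =o_\oo (fun k : nat => (k%:R^-1 : R^o)).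
Proof.
move=> C0 small g0 gC; apply/eqoP => eps eps0.
have [N _ dN] := small _ (divr_gt0 eps0 C0).
exists N.+2 => // -[|[|k]] //= Nk.
rewrite !ger0_norm ?invr_ge0 // (le_trans (gC k)) // ler_pdivlMr // mulrAC mulrC.
have := dN k Nk; rewrite /= ler_pdivlMr //; lra.
Qed.

End Fejer.

(** * Monotonicity of subdifferentials and first-order optimality *)

Section Subdifferential.
Context {R : realType} {n : nat}.
Implicit Types (f : 'cV[R]_n -> \bar R) (x y g h : 'cV[R]_n).

Lemma subdifferential_fin_num f x g :
  Defs.proper f -> subdifferential f x g -> f x \is a fin_num.
Proof.
move=> [fN [z fz]] sub; have := sub z; have := fN x; have := fN z; move: fz.
by case: (f x) => [r||] //; case: (f z).
Qed.

Lemma subdifferential_monotone f x y g h : Defs.proper f ->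
  subdifferential f x g -> subdifferential f y h -> 0 <= dot (g - h) (x - y).
Proof.
move=> pf sx sy; have := sx y; have := sy x.
have := subdifferential_fin_num pf sx.
have := subdifferential_fin_num pf sy.
case: (f x) => // a; case: (f y) => // b _ _.
by rewrite -!EFinD !lee_fin !dot_expand; lra.
Qed.

(* First-order optimality: the convexity inequality is divided by [t], and
   the quadratic term of the penalty vanishes as [t] tends to 0. *)
Lemma argmin_add_sqnorm_subdifferential p f (A : 'M[R]_(p, n)) b rho x :
  Defs.proper f -> convex_efun f -> 0 < rho ->
  argmin (fun z => f z + (rho / 2 * sqnorm (A *m z - b))%:E)%E x ->
  subdifferential f x (- (rho *: (A^T *m (A *m x - b)))).
Proof.
move=> [fN [z0 fz0]] cf rho0 minx y.
have fx : f x \is a fin_num.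
  have := minx z0; have := fN x; have := fN z0; move: fz0.
  by case: (f x) => [r||] //; case: (f z0).
have := fN y; case fyE : (f y) => [fy||] // _; last by rewrite leey.
case fxE : (f x) fx => [fx||] // _; rewrite -EFinD lee_fin.
set s := A *m x - b; set v := A *m (y - x).
have dE : dot (- (rho *: (A^T *m s))) (y - x) = - (rho * dot s v).
  by rewrite dotNl dotZl dot_trmx.
rewrite dE; set K := rho / 2 * sqnorm v.
have K0 : 0 <= K by rewrite mulr_ge0 ?sqnorm_ge0 // divr_ge0 // ltW.
have key t : 0 < t <= 1 -> fx - fy - rho * dot s v <= t * K.
  move=> /andP[t0 t1]; have := minx (t *: y + (1 - t) *: x).
  have /cf : 0 <= t <= 1 by rewrite ltW.
  move=> /(_ y x); rewrite fxE fyE.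
  have := fN (t *: y + (1 - t) *: x).
  case: (f (t *: y + (1 - t) *: x)) => [fz||] // _.
  rewrite -!EFinM -!EFinD !lee_fin.
  have -> : A *m (t *: y + (1 - t) *: x) - b = s + t *: v.
    rewrite /s /v mulmxBr mulmxDr -!scalemxAr.
    by apply/matrixP => i j; rewrite !mxE; ring.
  have -> : sqnorm (s + t *: v) = sqnorm s + 2 * t * dot s v + t ^+ 2 * sqnorm v.
    by clearbody s v; rewrite /sqnorm !dot_expand (dotC v s); ring.
  rewrite -/s => h1 h2.
  have : 0 <= t * (fy - fx + rho * dot s v + t * K) by rewrite /K; lra.
  by rewrite pmulr_rge0 //; lra.
rewrite leNgt; apply/negP => neg.
set D := fx - fy - rho * dot s v in key.
have D0 : 0 < D by rewrite /D; lra.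
have DK0 : 0 < D + K by lra.
(* With t = D / (D + K), [key] gives D (D + K) <= D K, contradicting D > 0; this t is legitimate
   even if K = 0. *)
have : 0 < D / (D + K) <= 1.
  by rewrite divr_gt0 // ler_pdivrMr // mul1r lerDl.
move=> /key; rewrite mulrAC ler_pdivlMr //.
have : 0 < D * D by rewrite mulr_gt0.
by lra.
Qed.

End Subdifferential.

(** * One ADMM step and the H-semi-norm *)

Section Steps.
Context {R : realType} {n1 n2 m : nat}.
Variables (f1 : 'cV[R]_n1 -> \bar R) (f2 : 'cV[R]_n2 -> \bar R).
Variables (A1 : 'M[R]_(m, n1)) (A2 : 'M[R]_(m, n2)) (c : 'cV[R]_m) (rho : R).

(* An ADMM step seen through its optimality conditions only: unlike for
   [ADMM_step], KKT points are then fixed points by inspection. *)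
Record stationary_step (x2 : 'cV[R]_n2) (l : 'cV[R]_m)
    (x1' : 'cV[R]_n1) (x2' : 'cV[R]_n2) (l' : 'cV[R]_m) : Prop := StationaryStep {
  stationary1 : subdifferential f1 x1' (A1^T *m (l' + rho *: (A2 *m x2' - A2 *m x2)));
  stationary2 : subdifferential f2 x2' (A2^T *m l');
  multiplier_step : l' = l - rho *: (A1 *m x1' + A2 *m x2' - c) }.

Lemma KKT_stationary_step x1 x2 l :
  KKT_point f1 f2 A1 A2 c x1 x2 l -> stationary_step x2 l x1 x2 l.
Proof.
move=> [s1 s2 feas]; split=> //; first by rewrite subrr scaler0 addr0.
by rewrite feas subrr scaler0 subr0.
Qed.

(** Each penalty gradient is rewritten by the multiplier update. The first subproblem still uses the
    old [x2], whence the shift by rho (A2 x2' - A2 x2) in its condition only. *)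
Lemma ADMM_stationary_step x2 l x1' x2' l' :
  closed_proper_convex f1 -> closed_proper_convex f2 -> 0 < rho ->
  ADMM_step f1 f2 A1 A2 c rho x2 l x1' x2' l' ->
  stationary_step x2 l x1' x2' l'.
Proof.
move=> [_ pf1 cf1] [_ pf2 cf2] rho0 [min1 min2 lE].
have rhoV (v : 'cV[R]_m) : rho *: (rho^-1 *: v) = v.
  by rewrite scalerA mulfV ?scale1r // gt_eqF.
split=> //.
- have : argmin (fun z => f1 z +
      (rho / 2 * sqnorm (A1 *m z - (c + rho^-1 *: l - A2 *m x2)))%:E)%E x1'.
    move=> z; have := min1 z; rewrite /penalty.
    have E y : A1 *m y + A2 *m x2 - c - rho^-1 *: l =
        A1 *m y - (c + rho^-1 *: l - A2 *m x2).
      by apply/matrixP => i j; rewrite !mxE; ring.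
    by rewrite !E.
  move/(argmin_add_sqnorm_subdifferential pf1 cf1 rho0).
  rewrite -scalerN -mulmxN scalemxAr lE; congr (subdifferential _ _ (_ *m _)).
  apply/matrixP => i j; rewrite !mxE.
  by field; rewrite gt_eqF.
- have : argmin (fun z => f2 z +
      (rho / 2 * sqnorm (A2 *m z - (c + rho^-1 *: l - A1 *m x1')))%:E)%E x2'.
    move=> z; have := min2 z; rewrite /penalty.
    have E y : A1 *m x1' + A2 *m y - c - rho^-1 *: l =
        A2 *m y - (c + rho^-1 *: l - A1 *m x1').
      by apply/matrixP => i j; rewrite !mxE; ring.
    by rewrite !E.
  move/(argmin_add_sqnorm_subdifferential pf2 cf2 rho0).
  rewrite -scalerN -mulmxN scalemxAr lE; congr (subdifferential _ _ (_ *m _)).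
  apply/matrixP => i j; rewrite !mxE.
  by field; rewrite gt_eqF.
Qed.

Lemma sqnorm_HmxE (w : 'cV[R]_(n2 + m)) : sqnorm_mx (Hmx A2 rho) w =
  rho * sqnorm (A2 *m usubmx w) + rho^-1 * sqnorm (dsubmx w).
Proof.
rewrite -{1}[w]vsubmxK /sqnorm_mx /Hmx tr_col_mx mul_row_block !mulmx0 addr0 add0r.
rewrite mul_row_col mxE; congr (_ + _).
  by rewrite -scalemxAr -scalemxAl mxE /sqnorm /dot trmx_mul !mulmxA.
by rewrite mul_mx_scalar -scalemxAl mxE.
Qed.

Lemma sqnorm_Hmx_wvecB x2 l y2 k :
  sqnorm_mx (Hmx A2 rho) (wvec x2 l - wvec y2 k) =
  rho * sqnorm (A2 *m (x2 - y2)) + rho^-1 * sqnorm (l - k).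
Proof. by rewrite sqnorm_HmxE !linearB /= /wvec !col_mxKu !col_mxKd. Qed.

(* Both monotonicity inequalities, added up and doubled, give exactly the
   difference of the two sides. *)
Lemma stationary_step_nonexpansive x2 l x1' x2' l' y2 k y1' y2' k' :
  Defs.proper f1 -> Defs.proper f2 -> 0 < rho ->
  stationary_step x2 l x1' x2' l' -> stationary_step y2 k y1' y2' k' ->
  sqnorm_mx (Hmx A2 rho) (wvec x2' l' - wvec y2' k')
    + rho * sqnorm (A2 *m (x2 - y2 - (x2' - y2'))
                    + rho^-1 *: ((l - k) - (l' - k')))
  <= sqnorm_mx (Hmx A2 rho) (wvec x2 l - wvec y2 k).
Proof.
move=> pf1 pf2 rho0 [s1 s2 lE] [t1 t2 kE].
have := subdifferential_monotone pf1 s1 t1.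
have := subdifferential_monotone pf2 s2 t2.
rewrite -!mulmxBr !dot_trmx.
(* The multiplier updates eliminate the first block, so that only quantities seen by H remain. *)
have -> : A1 *m (x1' - y1') = rho^-1 *: ((l - k) - (l' - k')) - A2 *m (x2' - y2').
  rewrite lE kE !mulmxBr; apply/matrixP => i j; rewrite !mxE; field.
  by rewrite gt_eqF.
have -> : l' + rho *: (A2 *m (x2' - x2)) - (k' + rho *: (A2 *m (y2' - y2)))
    = (l' - k') + rho *: (A2 *m (x2' - y2') - A2 *m (x2 - y2)).
  by rewrite !mulmxBr; apply/matrixP => i j; rewrite !mxE; ring.
rewrite !sqnorm_Hmx_wvecB [A2 *m (x2 - y2 - _)]mulmxBr.
move: (l - k) (l' - k') (A2 *m (x2 - y2)) (A2 *m (x2' - y2')) => dl dl' dp dp'.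
rewrite /sqnorm !dot_expand (dotC dl' dl) (dotC dp dl) (dotC dp dl').
rewrite (dotC dp' dl) (dotC dp' dl') (dotC dp' dp) => mono2 mono1.
rewrite -subr_ge0; move: (addr_ge0 mono1 mono2).
rewrite -(pmulr_rge0 _ (ltr0n R 2)).
congr (0 <= _); field.
by rewrite gt_eqF.
Qed.

(** H sees only A2 x2 and lambda. Equality of the former cancels the shift in the first optimality
    condition; equality of the latter is feasibility. *)
Lemma fixed_stationary_step_KKT x2 l x1' x2' l' : 0 < rho ->
  stationary_step x2 l x1' x2' l' ->
  sqnorm_mx (Hmx A2 rho) (wvec x2' l' - wvec x2 l) = 0 ->
  KKT_point f1 f2 A1 A2 c x1' x2' l'.
Proof.
move=> rho0 [s1 s2 lE]; rewrite sqnorm_Hmx_wvecB => /eqP.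
have rhoN0 : rho != 0 by rewrite gt_eqF.
rewrite paddr_eq0 ?mulr_ge0 ?invr_ge0 ?sqnorm_ge0 ?(ltW rho0) //.
rewrite !mulf_eq0 invr_eq0 (negbTE rhoN0) /=.
move=> /andP[/eqP/sqnorm_eq0 p0 /eqP/sqnorm_eq0 l0].
split=> //; first by move: s1; rewrite -mulmxBr p0 scaler0 addr0.
move/eqP: l0; rewrite {1}lE addrAC subrr add0r oppr_eq0 scaler_eq0 (negbTE rhoN0) /=.
by rewrite subr_eq0 => /eqP.
Qed.

(** A factor B with B^T B = H: the H-semi-norm is the Euclidean norm of the image under B. *)
Definition Hfactor : 'M[R]_(m + m, n2 + m) :=
  block_mx (Num.sqrt rho *: A2) 0 0 (Num.sqrt rho^-1)%:M.

Lemma sqnorm_HfactorE w : 0 < rho ->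
  sqnorm (Hfactor *m w) = sqnorm_mx (Hmx A2 rho) w.
Proof.
move=> rho0; rewrite sqnorm_HmxE -{1}[w]vsubmxK mul_block_col !mul0mx addr0 add0r.
rewrite sqnorm_col_mx -scalemxAl mul_scalar_mx !sqnormZ.
by rewrite !sqr_sqrtr ?invr_ge0 ?ltW.
Qed.

Lemma sqnorm_Hmx_ge0 w : 0 < rho -> 0 <= sqnorm_mx (Hmx A2 rho) w.
Proof. by move=> rho0; rewrite -sqnorm_HfactorE // sqnorm_ge0. Qed.

End Steps.

(** * Residual rates and convergence of the ADMM iterates *)

Section ADMMSequence.
Context {R : realType} {n1 n2 m : nat}.
Variables (f1 : 'cV[R]_n1 -> \bar R) (f2 : 'cV[R]_n2 -> \bar R).
Variables (A1 : 'M[R]_(m, n1)) (A2 : 'M[R]_(m, n2)) (c : 'cV[R]_m) (rho : R).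
Variables (x1 : nat -> 'cV[R]_n1) (x2 : nat -> 'cV[R]_n2) (lam : nat -> 'cV[R]_m).
Variables (x1s : 'cV[R]_n1) (x2s : 'cV[R]_n2) (lams : 'cV[R]_m).

Hypotheses (f1_cpc : closed_proper_convex f1) (f2_cpc : closed_proper_convex f2).
Hypothesis KKT_s : KKT_point f1 f2 A1 A2 c x1s x2s lams.
Hypothesis rho0 : 0 < rho.
Hypothesis admm : ADMM_sequence f1 f2 A1 A2 c rho x1 x2 lam.

Let Hn := sqnorm_mx (Hmx A2 rho).
Let w k := wvec (x2 k) (lam k).
Let d k := Hn (w k - w k.+1).

Let f1_proper : Defs.proper f1. Proof. by case: f1_cpc. Qed.
Let f2_proper : Defs.proper f2. Proof. by case: f2_cpc. Qed.

Let step k : stationary_step f1 f2 A1 A2 c rho (x2 k) (lam k)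
  (x1 k.+1) (x2 k.+1) (lam k.+1).
Proof. exact: ADMM_stationary_step. Qed.

Let Hn_ge0 v : 0 <= Hn v. Proof. exact: sqnorm_Hmx_ge0. Qed.

Let HnB u v : Hn (u - v) = Hn (v - u).
Proof. by rewrite /Hn -!(sqnorm_HfactorE _ _ rho0) -opprB mulmxN sqnormN. Qed.

(** The comparison step is arbitrary, so as to cover other iterates, KKT points and a step from the
    limit. *)
Lemma ADMM_step_Hmx_le k y2 l y1' y2' l' :
  stationary_step f1 f2 A1 A2 c rho y2 l y1' y2' l' ->
  Hn (w k.+1 - wvec y2' l') <= Hn (w k - wvec y2 l).
Proof.
move=> st; have := stationary_step_nonexpansive
  f1_proper f2_proper rho0 (step k) st.
by apply: le_trans; rewrite lerDl mulr_ge0 ?sqnorm_ge0 // ltW.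
Qed.

Lemma ADMM_Hmx_nonexpansive j k : Hn (w j.+1 - w k.+1) <= Hn (w j - w k).
Proof. exact: (ADMM_step_Hmx_le j (step k)). Qed.

Lemma ADMM_Hmx_dist_KKT_le k : Hn (w k - wvec x2s lams) <= Hn (w 0%N - wvec x2s lams).
Proof.
elim: k => // k; apply: le_trans; apply: (@ADMM_step_Hmx_le _ _ _ x1s).
exact: KKT_stationary_step.
Qed.

(* The shift by one is needed: the cross term is nonnegative because [lam k.+1]
   and [lam k.+2] come from subgradients of [f2], which [lam 0] need not. *)
Lemma ADMM_Hmx_fejer k :
  Hn (w k.+2 - wvec x2s lams) + d k.+1 <= Hn (w k.+1 - wvec x2s lams).
Proof.
have := stationary_step_nonexpansive
  f1_proper f2_proper rho0 (step k.+1) (KKT_stationary_step rho KKT_s).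
apply: le_trans; rewrite lerD2l /d /Hn sqnorm_Hmx_wvecB.
rewrite !opprB !addrA !subrK.
have := subdifferential_monotone f2_proper (stationary2 (step k))
  (stationary2 (step k.+1)).
rewrite -mulmxBr dot_trmx.
move: (lam _ - _) (A2 *m _) => dl dp mono.
(* The gain in the nonexpansiveness inequality is the residual plus a cross term whose sign is given
   by [mono]. *)
have -> : rho * sqnorm (dp + rho^-1 *: dl) =
    rho * sqnorm dp + rho^-1 * sqnorm dl + 2 * dot dl dp.
  by rewrite /sqnorm !dot_expand (dotC dp dl); field; rewrite gt_eqF.
by rewrite lerDl mulr_ge0.
Qed.

Lemma ADMM_residual_small eps : 0 < eps ->
  \forall k \near \oo, k.+2%:R * d k.+1 <= eps.
Proof.
apply: (@nonincreasing_summable_littleo _ _ (fun k => Hn (w k.+1 - wvec x2s lams))) => //.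
- by move=> k; exact: Hn_ge0.
- by move=> k; exact: ADMM_Hmx_nonexpansive.
- exact: ADMM_Hmx_fejer.
Qed.

Lemma ADMM_residual_littleo :
  (d : nat -> R^o) =o_\oo (fun k : nat => (k%:R^-1 : R^o)).
Proof.
apply: (@littleo_inv_nat _ _ _ 1 _ ADMM_residual_small) => // k; first exact: Hn_ge0.
by rewrite mul1r; exact: ADMM_Hmx_nonexpansive.
Qed.

(** The multiplier update determines A1 x1^{k+1} from A2 x2^{k+1} and the multiplier increment, so
    its variation is controlled by two consecutive residuals. *)
Lemma ADMM_primal_dual_littleo :
  (fun k : nat => sqnorm (A1 *m x1 k - A1 *m x1 k.+1)
                + sqnorm (A2 *m x2 k - A2 *m x2 k.+1)
                + sqnorm (lam k - lam k.+1) : R^o)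
    =o_\oo (fun k : nat => (k%:R^-1 : R^o)).
Proof.
(* In units of d_{k+1}, the A1 term costs (4 + 4 + 2) / rho by two uses of [sqnormD_le], the A2 term
   1 / rho, and the multiplier term rho. *)
have C0 : 0 < 11 * rho^-1 + rho by rewrite addr_gt0 // mulr_gt0 // invr_gt0.
apply: (littleo_inv_nat C0 ADMM_residual_small) => k.
  by rewrite !addr_ge0 ?sqnorm_ge0.
have rV0 : 0 < rho^-1 by rewrite invr_gt0.
have Pd i : sqnorm (A2 *m (x2 i - x2 i.+1)) <= rho^-1 * d i.
  rewrite /d /Hn sqnorm_Hmx_wvecB mulrDr mulKf ?gt_eqF // lerDl.
  by rewrite !mulr_ge0 ?sqnorm_ge0 // ltW.
have Ld i : sqnorm (lam i - lam i.+1) <= rho * d i.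
  rewrite /d /Hn sqnorm_Hmx_wvecB mulrDr mulVKf ?gt_eqF // lerDr.
  by rewrite !mulr_ge0 ?sqnorm_ge0 // ltW.
have dS : d k.+2 <= d k.+1 := ADMM_Hmx_nonexpansive k.+1 k.+2.
have A1x i : A1 *m x1 i.+1 = c - A2 *m x2 i.+1 + rho^-1 *: (lam i - lam i.+1).
  rewrite (multiplier_step (step i)) opprB addrCA subrr addr0.
  rewrite scalerA mulVf ?gt_eqF // scale1r.
  by apply/matrixP => a b; rewrite !mxE; ring.
have -> : A1 *m x1 k.+2 - A1 *m x1 k.+3 =
    rho^-1 *: (lam k.+1 - lam k.+2) + - (rho^-1 *: (lam k.+2 - lam k.+3))
    + - (A2 *m (x2 k.+2 - x2 k.+3)).
  by rewrite !A1x mulmxBr; apply/matrixP => i j; rewrite !mxE; ring.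
have := sqnormD_le (rho^-1 *: (lam k.+1 - lam k.+2)) (- (rho^-1 *: (lam k.+2 - lam k.+3))).
have := sqnormD_le (rho^-1 *: (lam k.+1 - lam k.+2) + - (rho^-1 *: (lam k.+2 - lam k.+3)))
  (- (A2 *m (x2 k.+2 - x2 k.+3))).
rewrite !sqnormN !sqnormZ -!mulmxBr.
have rL i : rho^-1 ^+ 2 * sqnorm (lam i - lam i.+1) <= rho^-1 * d i.
  by rewrite expr2 -mulrA ler_wpM2l ?(ltW rV0) // mulrC ler_pdivrMr // mulrC Ld.
have := rL k.+1; have := rL k.+2; have := Pd k.+2; have := Ld k.+2.
have : rho * d k.+2 <= rho * d k.+1 by rewrite ler_wpM2l // ltW.
have : rho^-1 * d k.+2 <= rho^-1 * d k.+1 by rewrite ler_wpM2l // ltW.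
by lra.
Qed.

Lemma ADMM_Hmx_cvg : exists v : 'cV[R]_(n2 + m), (fun k => Hn (w k - v)) @ \oo --> (0 : R).
Proof.
(* Centring at the KKT point turns the bound on distances to it into boundedness of the orbit and
   leaves differences unchanged. *)
pose B := Hfactor A2 rho; pose u k := w k - wvec x2s lams.
have HnE v : sqnorm (B *m v) = Hn v by exact: sqnorm_HfactorE.
have uB j k : u j - u k = w j - w k by rewrite /u opprB addrA subrK.
have dcvg : (fun k => sqnorm (B *m (u k - u k.+1))) @ \oo --> (0 : R).
  under eq_fun do rewrite uB HnE.
  apply/cvgrPdist_le => e e0; have [N _ dN] := ADMM_residual_small e0.
  exists N.+1 => // -[|k] //= Nk; rewrite sub0r normrN ger0_norm ?Hn_ge0 //.
  apply: le_trans (dN k Nk); rewrite /= ler_peMl ?Hn_ge0 //.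
  by rewrite ler1n.
have bounded k : sqnorm (B *m u k) <= Hn (u 0%N).
  by rewrite HnE; exact: ADMM_Hmx_dist_KKT_le.
have nonexp j k : sqnorm (B *m (u j.+1 - u k.+1)) <= sqnorm (B *m (u j - u k)).
  by rewrite !uB !HnE; exact: ADMM_Hmx_nonexpansive.
have [v vcvg] := nonexpansive_orbit_cvg bounded nonexp dcvg.
exists (wvec x2s lams + v); move: vcvg.
by under eq_fun do rewrite HnE /u -addrA -opprD.
Qed.

(* One further step from the limit: nonexpansiveness forces it to stay put in the
   semi-norm, so it is a fixed point. *)
Lemma ADMM_Hmx_limit_KKT v : ADMM_well_defined f1 f2 A1 A2 c rho ->
  (fun k => Hn (w k - v)) @ \oo --> (0 : R) ->
  exists2 v', is_solution f1 f2 A1 A2 c v' & (fun k => Hn (w k - v')) @ \oo --> (0 : R).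
Proof.
move=> wd vcvg; have vE : v = wvec (usubmx v) (dsubmx v) by rewrite /wvec vsubmxK.
have [y1 [y2 [l /(ADMM_stationary_step f1_cpc f2_cpc rho0) st]]] :=
  wd (usubmx v) (dsubmx v).
exists (wvec y2 l).
  exists y1, y2, l; split=> //; apply: (fixed_stationary_step_KKT rho0 st).
  rewrite -vE; apply/eqP; rewrite eq_le Hn_ge0 andbT; apply/ler_addgt0Pr => e e0.
  (* The new point and v both lie within e / 4 of w_{N+1} in squared semi-norm, and [sqnormD_le]
     doubles each term. *)
  have e4 : 0 < e / 4 by rewrite divr_gt0.
  have [N _ vN] : \forall k \near \oo, Hn (w k - v) < e / 4 by move/cvgr_lt: vcvg; apply.
  have h1 := vN N (leqnn N); have h2 := vN N.+1 (leqnSn N).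
  rewrite /= in h1 h2; have := ADMM_step_Hmx_le N st; rewrite -vE HnB => h3.
  have := sqnormD_le (Hfactor A2 rho *m (wvec y2 l - w N.+1))
    (Hfactor A2 rho *m (w N.+1 - v)).
  rewrite -mulmxDr addrA subrK !sqnorm_HfactorE // -!/(Hn _).
  by lra.
(* The distance of w_{k+1} to the new point is at most that of w_k to v. *)
rewrite -cvg_shiftS; apply: (squeeze_cvgr _ (cvg_cst 0) vcvg).
apply: nearW => k /=; rewrite Hn_ge0 /=.
by rewrite vE (ADMM_step_Hmx_le _ st).
Qed.

End ADMMSequence.

Theorem theorem5p1 (R : realType) (n1 n2 m : nat)
    (f1 : 'cV[R]_n1 -> \bar R) (f2 : 'cV[R]_n2 -> \bar R)
    (A1 : 'M[R]_(m, n1)) (A2 : 'M[R]_(m, n2)) (c : 'cV[R]_m) (rho : R)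
    (x1 : nat -> 'cV[R]_n1) (x2 : nat -> 'cV[R]_n2) (lam : nat -> 'cV[R]_m) :
  closed_proper_convex f1 ->
  closed_proper_convex f2 ->
  (exists x1s x2s lams, KKT_point f1 f2 A1 A2 c x1s x2s lams) ->
  0 < rho ->
  ADMM_sequence f1 f2 A1 A2 c rho x1 x2 lam ->
  [/\ exists ws : 'cV[R]_(n2 + m),
        (ADMM_well_defined f1 f2 A1 A2 c rho ->
           is_solution f1 f2 A1 A2 c ws) /\
        (fun k : nat => sqnorm_mx (Hmx A2 rho) (wvec (x2 k) (lam k) - ws)) @ \oo --> (0 : R),
      (fun k : nat => sqnorm_mx (Hmx A2 rho)
         (wvec (x2 k) (lam k) - wvec (x2 k.+1) (lam k.+1)) : R^o)
        =o_\oo (fun k : nat => (k%:R^-1 : R^o))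
    & (fun k : nat => sqnorm (A1 *m x1 k - A1 *m x1 k.+1)
                    + sqnorm (A2 *m x2 k - A2 *m x2 k.+1)
                    + sqnorm (lam k - lam k.+1) : R^o)
        =o_\oo (fun k : nat => (k%:R^-1 : R^o))].
Proof.
move=> cpc1 cpc2 [x1s [x2s [lams KKT_s]]] rho0 admm; split.
- have [v vcvg] := ADMM_Hmx_cvg cpc1 cpc2 KKT_s rho0 admm.
  (* The witness is chosen before well-definedness is assumed, hence the classical case split. *)
  have [wd|nwd] := pselect (ADMM_well_defined f1 f2 A1 A2 c rho); last by exists v.
  have [v' sol cvg'] := ADMM_Hmx_limit_KKT cpc1 cpc2 rho0 admm wd vcvg.
  by exists v'.
- exact: ADMM_residual_littleo cpc1 cpc2 KKT_s rho0 admm.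
- exact: ADMM_primal_dual_littleo cpc1 cpc2 KKT_s rho0 admm.
Qed.
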